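(* There exists a universal constant $\sigma>0$ such that $$\frac{1}{\operatorname{diam}(\Sigma)}\int_\Sigma |H| \;\geq\; \pi+\sigma\, U(\Sigma)$$ holds for every simply-connected axisymmetric surface $\Sigma\subset\mathbb{R}^3$.
   Context: A surface is a closed surface smoothly immersed in $\mathbb{R}^3$ (not necessarily embedded). $H$ is the mean curvature, defined as the average of the two principal curvatures (so $|H|\equiv1$ on the unit sphere); the integral is with respect to the induced area measure. $\operatorname{diam}(\Sigma)$ is the extrinsic diameter, i.e. the maximal Euclidean distance in $\mathbb{R}^3$ between two points of $\Sigma$. A simply-connected axisymmetric surface is a connected, simply-connected surface (a topological sphere) that is rotationally symmetric around a line $L_{\mathrm{axis}}$. Up to a rigid motion it has the form $$\Sigma=\{(x(s)\cos\phi,\,x(s)\sin\phi,\,z(s)) : 0\le s\le L,\ 0\le\phi<2\pi\},$$ where $\gamma=(x,z):[0,L]\to\mathbb{R}^2$ is an immersed plane curve parametrized by arclength $s$, with $x(0)=z(0)=x(L)=0$, $z(L)\ge0$, $\gamma_s(0)=(1,0)$, $\gamma_s(L)=(-1,0)$, and $x(s)>0$ for $s\in(0,L)$; the $z$-axis is then $L_{\mathrm{axis}}$. The scale-invariant quantity $U$ is defined by $$U(\Sigma):=\Big(\int_0^1\sqrt{1-T(t)\cdot\omega_{\mathrm{axis}}}\,dt\Big)^2,$$ where $\omega_{\mathrm{axis}}$ is a unit vector parallel to an axis of symmetry $L_{\mathrm{axis}}$, and $T$ is the unit tangent of a constant-speed minimal geodesic $\gamma_\Sigma:[0,1]\to\Sigma\subset\mathbb{R}^3$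 in $\Sigma$ (with respect to the intrinsic metric) connecting the pair of points of $\Sigma$ on $L_{\mathrm{axis}}$ (the two poles, corresponding to $s=0$ and $s=L$), oriented such that $\gamma_\Sigma(1)-\gamma_\Sigma(0)=\lambda\,\omega_{\mathrm{axis}}$ for some $\lambda\ge0$. Such $\gamma_\Sigma$ is a meridian, i.e. a generating curve, so that revolving it around $L_{\mathrm{axis}}$ gives $\Sigma$; in the coordinates above one may take $\omega_{\mathrm{axis}}=(0,0,1)$ and $\gamma_\Sigma(t)=(x(Lt),0,z(Lt))$. If several choices of $(\omega_{\mathrm{axis}},\gamma_\Sigma)$ are admissible, any of them may be used. *)

(* Defs.v *)
From Stdlib Require Import Reals Lra.
From Coquelicot Require Import Coquelicot.
Open Scope R_scope.

(** * Euclidean 3-space *)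

Definition vec : Type := (R * R * R)%type.

Definition cx (p : vec) : R := fst (fst p).
Definition cy (p : vec) : R := snd (fst p).
Definition cz (p : vec) : R := snd p.

Definition vadd (p q : vec) : vec := (cx p + cx q, cy p + cy q, cz p + cz q).
Definition vscal (a : R) (p : vec) : vec := (a * cx p, a * cy p, a * cz p).
Definition vsub (p q : vec) : vec := vadd p (vscal (-1) q).
Definition dot (p q : vec) : R := cx p * cx q + cy p * cy q + cz p * cz q.
Definition cross (p q : vec) : vec :=
  (cy p * cz q - cz p * cy q, cz p * cx q - cx p * cz q, cx p * cy q - cy p * cx q).
Definition vnorm (p : vec) : R := sqrt (dot p p).
Definition vunit (p : vec) : vec := vscal (/ vnorm p) p.

Definition orthonormal (e1 e2 e3 : vec) : Prop :=
  dot e1 e1 = 1 /\ dot e2 e2 = 1 /\ dot e3 e3 = 1 /\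
  dot e1 e2 = 0 /\ dot e1 e3 = 0 /\ dot e2 e3 = 0.

Definition velocity (c : R -> vec) (t : R) : vec :=
  (Derive (fun r => cx (c r)) t, Derive (fun r => cy (c r)) t,
   Derive (fun r => cz (c r)) t).

Definition diameter (S : vec -> Prop) : R :=
  real (Lub_Rbar (fun d => exists p q, S p /\ S q /\ d = vnorm (vsub p q))).

(** * Local geometry of a parametrized surface *)

Definition d1 (F : R -> R -> vec) (u v : R) : vec := velocity (fun r => F r v) u.
Definition d2 (F : R -> R -> vec) (u v : R) : vec := velocity (fun r => F u r) v.

Definition normal (F : R -> R -> vec) (u v : R) : vec :=
  vunit (cross (d1 F u v) (d2 F u v)).

(* First fundamental form [E du^2 + 2 F du dv + G dv^2]. *)
Definition I11 F u v := dot (d1 F u v) (d1 F u v).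
Definition I12 F u v := dot (d1 F u v) (d2 F u v).
Definition I22 F u v := dot (d2 F u v) (d2 F u v).

(* Second fundamental form [L du^2 + 2 M du dv + N dv^2]. *)
Definition II11 F u v := dot (d1 (d1 F) u v) (normal F u v).
Definition II12 F u v := dot (d1 (d2 F) u v) (normal F u v).
Definition II22 F u v := dot (d2 (d2 F) u v) (normal F u v).

(* [det (II - k I) = detI * k^2 - mixI_II * k + detII] *)
Definition detI F u v := I11 F u v * I22 F u v - I12 F u v ^ 2.
Definition detII F u v := II11 F u v * II22 F u v - II12 F u v ^ 2.
Definition mixI_II F u v :=
  I11 F u v * II22 F u v - 2 * I12 F u v * II12 F u v + I22 F u v * II11 F u v.

Definition curv_disc F u v := mixI_II F u v ^ 2 - 4 * detI F u v * detII F u v.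

Definition principal_curvature_max F u v :=
  (mixI_II F u v + sqrt (curv_disc F u v)) / (2 * detI F u v).
Definition principal_curvature_min F u v :=
  (mixI_II F u v - sqrt (curv_disc F u v)) / (2 * detI F u v).

(* The two values above are the eigenvalues, with multiplicity, of the second
   fundamental form relative to the first one. *)
Lemma principal_curvatures_spec F u v k :
  0 < detI F u v ->
  (II11 F u v - k * I11 F u v) * (II22 F u v - k * I22 F u v)
    - (II12 F u v - k * I12 F u v) ^ 2 =
  detI F u v * (k - principal_curvature_max F u v)
             * (k - principal_curvature_min F u v).
Proof.
intros Hd.
assert (HE : 0 < I11 F u v).
{ destruct (Req_dec (I11 F u v) 0) as [E0|E0].
  - unfold detI in Hd. rewrite E0 in Hd. pose proof (pow2_ge_0 (I12 F u v)). lra.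
  - assert (0 <= I11 F u v); [|lra].
    unfold I11, dot. pose proof (Rle_0_sqr (cx (d1 F u v))).
    pose proof (Rle_0_sqr (cy (d1 F u v))). pose proof (Rle_0_sqr (cz (d1 F u v))).
    unfold Rsqr in *. lra. }
assert (Hdisc : 0 <= curv_disc F u v).
{ assert (Heq : curv_disc F u v =
     (I11 F u v * II22 F u v - II11 F u v * I22 F u v
      - 2 * I12 F u v / I11 F u v
          * (I11 F u v * II12 F u v - I12 F u v * II11 F u v)) ^ 2
     + 4 * detI F u v
       * ((I11 F u v * II12 F u v - I12 F u v * II11 F u v) / I11 F u v) ^ 2).
  { unfold curv_disc, mixI_II, detI, detII. field. lra. }
  rewrite Heq. apply Rplus_le_le_0_compat; [apply pow2_ge_0|].
  apply Rmult_le_pos; [lra | apply pow2_ge_0]. }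
pose proof (sqrt_sqrt _ Hdisc) as Hs.
unfold principal_curvature_max, principal_curvature_min.
set (r := sqrt (curv_disc F u v)) in *.
replace (detI F u v * (k - (mixI_II F u v + r) / (2 * detI F u v))
           * (k - (mixI_II F u v - r) / (2 * detI F u v)))
  with (detI F u v * k ^ 2 - mixI_II F u v * k
        + (mixI_II F u v ^ 2 - r * r) / (4 * detI F u v)) by (field; lra).
rewrite Hs.
replace (mixI_II F u v ^ 2 - curv_disc F u v)
  with (4 * detI F u v * detII F u v) by (unfold curv_disc; ring).
replace (4 * detI F u v * detII F u v / (4 * detI F u v))
  with (detII F u v) by (field; lra).
unfold mixI_II, detI, detII. ring.
Qed.

Definition mean_curvature F u v :=
  (principal_curvature_max F u v + principal_curvature_min F u v) / 2.

Definition area_density F u v := vnorm (cross (d1 F u v) (d2 F u v)).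

(** * Axisymmetric spheres *)

Definition right_derivative (f : R -> R) (a l : R) : Prop :=
  filterlim (fun h => (f (a + h) - f a) / h) (at_right 0) (locally l).
Definition left_derivative (f : R -> R) (a l : R) : Prop :=
  filterlim (fun h => (f (a + h) - f a) / h) (at_left 0) (locally l).

Definition smooth_on_disc (L : R) (g : R -> R -> R) : Prop :=
  forall (n : nat) (p q : R), p ^ 2 + q ^ 2 < L ^ 2 -> ex_diff_n g n p q.

(* The cap swept by a profile starting on the axis, in the Cartesian
   coordinates [(p,q) = (r cos phi, r sin phi)].  At the centre
   [p = q = 0] the quotients are [0 / 0 = 0 * / 0 = 0], as they should be. *)
Definition smooth_cap (L : R) (rho zeta : R -> R) : Prop :=
  let r p q := sqrt (p ^ 2 + q ^ 2) in
  smooth_on_disc L (fun p q => rho (r p q) * p / r p q) /\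
  smooth_on_disc L (fun p q => rho (r p q) * q / r p q) /\
  smooth_on_disc L (fun p q => zeta (r p q)).

(* Arclength-parametrized generating curve on [0,L].  The two [smooth_cap]
   clauses say that the immersion of the sphere obtained by revolution is
   C^infinity, in the two charts omitting one pole each; the values of [x] and
   [z] outside [0,L] are irrelevant. *)
Definition generating_curve (L : R) (x z : R -> R) : Prop :=
  0 < L /\
  x 0 = 0 /\ z 0 = 0 /\ x L = 0 /\ 0 <= z L /\
  right_derivative x 0 1 /\ right_derivative z 0 0 /\
  left_derivative x L (-1) /\ left_derivative z L 0 /\
  (forall s, 0 < s < L -> 0 < x s) /\
  (forall s, 0 < s < L -> Derive x s ^ 2 + Derive z s ^ 2 = 1) /\
  smooth_cap L x z /\
  smooth_cap L (fun r => x (L - r)) (fun r => z (L - r)).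

(* [b] and the orthonormal frame [e1, e2, e3] encode the rigid motion; the axis
   of symmetry is the line [b + R e3]. *)
Definition revolve (b e1 e2 e3 : vec) (x z : R -> R) (s phi : R) : vec :=
  vadd b (vadd (vscal (x s * cos phi) e1)
         (vadd (vscal (x s * sin phi) e2) (vscal (z s) e3))).

Definition surface (L : R) (F : R -> R -> vec) (p : vec) : Prop :=
  exists s phi, 0 <= s <= L /\ 0 <= phi < 2 * PI /\ p = F s phi.

Definition total_abs_mean_curvature (L : R) (F : R -> R -> vec) : R :=
  RInt (fun s => RInt (fun phi =>
    Rabs (mean_curvature F s phi) * area_density F s phi) 0 (2 * PI)) 0 L.

(** * Minimal geodesics between the poles, and the quantity [U] *)

Definition C1_on_01 (f : R -> R) : Prop :=
  forall t, 0 <= t <= 1 -> ex_derive f t /\ continuous (Derive f) t.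

(* Curves on the abstract sphere are given by polar coordinates [(s, theta)],
   so that they cannot switch sheets where the immersion self-intersects.
   Curves that return to a pole can be shortened and are left out. *)
Definition pole_to_pole_curve (L : R) (F : R -> R -> vec) (c : R -> vec) : Prop :=
  exists s theta : R -> R,
    C1_on_01 s /\ C1_on_01 theta /\
    (forall t, 0 < t < 1 -> 0 < s t < L) /\
    ((s 0 = 0 /\ s 1 = L) \/ (s 0 = L /\ s 1 = 0)) /\
    (forall t, 0 <= t <= 1 -> c t = F (s t) (theta t)).

Definition curve_length (c : R -> vec) : R :=
  RInt (fun t => vnorm (velocity c t)) 0 1.

Definition minimal_geodesic (L : R) (F : R -> R -> vec) (c : R -> vec) : Prop :=
  pole_to_pole_curve L F c /\
  (exists v, forall t, 0 < t < 1 -> vnorm (velocity c t) = v) /\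
  (forall c', pole_to_pole_curve L F c' -> curve_length c <= curve_length c').

Definition admissible (L : R) (F : R -> R -> vec) (e3 omega : vec) (c : R -> vec)
  : Prop :=
  vnorm omega = 1 /\ (exists a, omega = vscal a e3) /\
  minimal_geodesic L F c /\
  (exists lambda, 0 <= lambda /\ vsub (c 1) (c 0) = vscal lambda omega).

Definition U (omega : vec) (c : R -> vec) : R :=
  RInt (fun t => sqrt (1 - dot (vunit (velocity c t)) omega)) 0 1 ^ 2.

(* Main.v *)
From Stdlib Require Import Reals Lra Psatz.
From Coquelicot Require Import Coquelicot.
Require Import Defs.
Open Scope R_scope.

(** Write the profile by arclength and let [theta] be its tangent angle, so that
    [x' = cos theta] and [z' = sin theta].  The principal curvatures are [theta']
    and [z' / x] and the area element is [x ds dphi], hence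
    [\int |H| = PI * \int_0^L |h| ds] with [h = z' + x theta'].

    Lower bound for [\int |h|] (calibration).  For every [g] with [|g| <= 1] one
    has [|h| >= h g].  If [g] is a function of [theta] with a periodic primitive
    [G], then [h g] equals a function of [theta] up to the derivative of
    [x * G(theta)], and that derivative integrates to [0] because [x] vanishes at
    both poles.  The choice [g = sin theta] gives [\int |h| >= L], the constant
    [PI] of the theorem.  Vertical profiles give equality there, and the choice
    [g = sin theta * (1 + cos^2 theta / 2)] pays for the horizontal part:
    [\int |h| >= L + J / 6], where [J = \int x'^2]
    ([RInt_abs_mean_density_ge]).

    The diameter [D].  Two points of the surface at heights [z1], [z2] and radii
    [x1], [x2] have squared distance at most [(x1 + x2)^2 + (z1 - z2)^2].  The
    first square is at most [L J], because the meridian starts and ends on the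
    axis.  So if [D] is close to [L] and [J] is small, the heights differ by
    almost [L], almost the whole length is spent between them, and as
    [z L >= 0] the profile rises by almost [L] from pole to pole:
    [L - z L <= 4 (L - D) + 2 J] ([height_defect_le]).  Also [D <= L]
    ([separation_le]).

    The quantity [U].  By the Cauchy-Schwarz inequality [U] is at most the mean of
    [1 - T . omega].  A minimal geodesic between the poles has length [L], so this
    mean is [1 - z L / L] ([U_le]).

    Together, [D U <= L - z L <= 4 (L - D) + 2 J <= 12 (\int |h| - D)], which is
    the theorem with [sigma = PI / 12].

    The integrals reach the poles, where the profile is known only on one side.
    Smoothness of the caps provides a twice continuously differentiable
    continuation [X], [Z] of the profile across both poles
    ([profile_extension]), and all integrals are taken along it. *)

(** * Twice differentiable extension of the profile *)

(** The derivatives are only required at the point itself, so that the notion can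
    be asked on a closed interval for functions defined beyond its ends. *)
Definition C2_at (f : R -> R) (s : R) : Prop :=
  ex_derive f s /\ ex_derive (Derive f) s /\ continuous (Derive (Derive f)) s.

Lemma locally_interval (a b s : R) (P : R -> Prop) :
  a < s < b -> (forall t, a < t < b -> P t) -> locally s P.
Proof.
  intros Hs HP.
  assert (He : 0 < Rmin (s - a) (b - s)) by (apply Rmin_pos; lra).
  exists (mkposreal _ He). intros t Ht.
  unfold ball in Ht. simpl in Ht. unfold AbsRing_ball, abs, minus, plus, opp in Ht.
  simpl in Ht. apply Rabs_def2 in Ht.
  pose proof (Rmin_l (s - a) (b - s)). pose proof (Rmin_r (s - a) (b - s)).
  apply HP. lra.
Qed.

Lemma locally_Derive_ext (f g : R -> R) (s : R) :
  locally s (fun t => f t = g t) -> locally s (fun t => Derive f t = Derive g t).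
Proof.
  intros H. apply locally_locally in H. revert H.
  apply filter_imp. intros t. apply Derive_ext_loc.
Qed.

Lemma C2_at_ext_loc (f g : R -> R) (s : R) :
  locally s (fun t => f t = g t) -> C2_at f s -> C2_at g s.
Proof.
  intros E (H0 & H1 & H2).
  pose proof (locally_Derive_ext _ _ _ E) as E1.
  pose proof (locally_Derive_ext _ _ _ E1) as E2.
  split; [|split].
  - exact (ex_derive_ext_loc _ _ _ E H0).
  - exact (ex_derive_ext_loc _ _ _ E1 H1).
  - apply continuous_ext_loc with (2 := H2). revert E2. apply filter_imp. now intros t ->.
Qed.

Lemma is_derive_reflect (f : R -> R) (L t d : R) :
  is_derive f (L - t) d -> is_derive (fun r => f (L - r)) t (- d).
Proof.
  intros H. replace (- d) with (scal (-1) d) by (unfold scal; simpl; unfold mult; simpl; ring).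
  apply (is_derive_comp f (fun r => L - r)); [exact H|].
  auto_derive; [trivial | ring].
Qed.

Lemma C2_at_reflect (f : R -> R) (L s : R) :
  locally (L - s) (C2_at f) -> C2_at (fun t => f (L - t)) s.
Proof.
  intros Hf.
  assert (Hl : forall P : R -> Prop, locally (L - s) P -> locally s (fun t => P (L - t))).
  { intros P HP. assert (Hc : continuous (fun t => L - t) s).
    { apply (continuous_minus (fun _ => L) (fun t => t));
        [apply continuous_const | apply continuous_id]. }
    exact (Hc P HP). }
  assert (E1 : locally s (fun t => - Derive f (L - t) = Derive (fun r => f (L - r)) t)).
  { apply Hl in Hf. revert Hf. apply filter_imp. intros t (H0 & _).
    symmetry. apply is_derive_unique, is_derive_reflect.
    now apply Derive_correct. }
  assert (E2 : locally s (fun t => Derive (Derive f) (L - t)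
                                   = Derive (Derive (fun r => f (L - r))) t)).
  { pose proof (locally_Derive_ext _ _ _ E1) as E2. apply Hl in Hf.
    pose proof (filter_and _ _ E2 Hf) as H. revert H. apply filter_imp.
    intros t (<- & _ & H1 & _).
    symmetry. apply is_derive_unique.
    replace (Derive (Derive f) (L - t)) with (- - Derive (Derive f) (L - t)) by ring.
    apply (is_derive_opp (fun r => Derive f (L - r))), is_derive_reflect.
    now apply Derive_correct. }
  pose proof (locally_singleton _ _ Hf) as (H0 & H1 & H2).
  split; [|split].
  - exists (- Derive f (L - s)). now apply is_derive_reflect, Derive_correct.
  - apply (ex_derive_ext_loc _ _ _ E1).
    apply (ex_derive_opp (fun t => Derive f (L - t))).
    exists (- Derive (Derive f) (L - s)). now apply is_derive_reflect, Derive_correct.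
  - apply continuous_ext_loc with (g := fun t => Derive (Derive f) (L - t)).
    + revert E2. apply filter_imp. now intros t ->.
    + apply (continuous_comp (fun t => L - t)); [|exact H2].
      apply (continuous_minus (fun _ => L) (fun t => t));
        [apply continuous_const | apply continuous_id].
Qed.

Lemma C2_at_slice (L : R) (g : R -> R -> R) (p : R) :
  smooth_on_disc L g -> - L < p < L -> C2_at (fun r => g r 0) p.
Proof.
  intros Hg Hp.
  assert (Hd : p ^ 2 + 0 ^ 2 < L ^ 2) by nra.
  destruct (Hg 2%nat p 0 Hd) as (_ & H0 & _ & (_ & H1 & _ & (H2 & _) & _) & _).
  split; [exact H0 | split; [exact H1 |]].
  apply continuity_2d_pt_filterlim in H2.
  apply (continuous_comp_2 (fun r => r) (fun _ => 0)
           (fun r q => Derive (fun r => Derive (fun r => g r q) r) r)).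
  - apply continuous_id.
  - apply continuous_const.
  - exact H2.
Qed.

Lemma sqrt_slice (p : R) : 0 <= p -> sqrt (p ^ 2 + 0 ^ 2) = p.
Proof. intros Hp. replace (p ^ 2 + 0 ^ 2) with (p ^ 2) by ring. now apply sqrt_pow2. Qed.

(** A smooth cap, cut by the plane [q = 0], is a meridian continued through the
    pole: the radius becomes an odd function and the height an even one.  This
    gives the regularity of the profile up to and across its end. *)
Lemma cap_extension (L : R) (rho zeta : R -> R) :
  rho 0 = 0 -> smooth_cap L rho zeta ->
  exists f g, (forall p, - L < p < L -> C2_at f p /\ C2_at g p) /\
              (forall p, 0 <= p -> f p = rho p /\ g p = zeta p).
Proof.
  intros H0 (Hx & _ & Hz).
  exists (fun p => rho (sqrt (p ^ 2 + 0 ^ 2)) * p / sqrt (p ^ 2 + 0 ^ 2)),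
         (fun p => zeta (sqrt (p ^ 2 + 0 ^ 2))).
  split.
  - intros p Hp. split; [exact (C2_at_slice _ _ _ Hx Hp) | exact (C2_at_slice _ _ _ Hz Hp)].
  - intros p Hp. rewrite (sqrt_slice p Hp). split; [|reflexivity].
    destruct (Req_dec p 0) as [->|Hn]; [rewrite H0; unfold Rdiv; ring | now field].
Qed.

(** The two continuations agree with the profile, hence with each other, between
    the poles; switching from one to the other at [L / 2] is therefore harmless. *)
Lemma C2_glue (L : R) (f g h : R -> R) :
  0 < L ->
  (forall p, - L < p < L -> C2_at f p) -> (forall p, - L < p < L -> C2_at g p) ->
  (forall p, 0 <= p -> f p = h p) -> (forall p, 0 <= p -> g p = h (L - p)) ->
  exists F, forall s, 0 <= s <= L -> C2_at F s /\ F s = h s.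
Proof.
  intros HL Hf Hg Ef Eg.
  exists (fun s => if Rle_dec s (L / 2) then f s else g (L - s)).
  intros s Hs. split.
  - destruct (Rle_lt_dec s (L / 2)) as [H|H].
    + apply (C2_at_ext_loc f); [|apply Hf; lra].
      apply (locally_interval (- L) L); [lra|]. intros t Ht.
      destruct (Rle_dec t (L / 2)); [reflexivity|].
      rewrite Ef, Eg by lra. f_equal; ring.
    + apply (C2_at_ext_loc (fun t => g (L - t))).
      * apply (locally_interval (L / 2) (L + 1)); [lra|]. intros t Ht.
        destruct (Rle_dec t (L / 2)); [lra | reflexivity].
      * apply C2_at_reflect. apply (locally_interval (- L) L); [lra|]. exact Hg.
  - destruct (Rle_dec s (L / 2)).
    + apply Ef; lra.
    + rewrite Eg by lra. f_equal; ring.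
Qed.

Lemma profile_extension (L : R) (x z : R -> R) :
  generating_curve L x z ->
  exists X Z, forall s, 0 <= s <= L ->
    C2_at X s /\ C2_at Z s /\ X s = x s /\ Z s = z s.
Proof.
  intros (HL & Hx0 & _ & HxL & _ & _ & _ & _ & _ & _ & _ & H0 & H1).
  apply cap_extension in H0 as (f0 & g0 & C0 & E0); [|exact Hx0].
  apply cap_extension in H1 as (f1 & g1 & C1 & E1); [|rewrite Rminus_0_r; exact HxL].
  destruct (C2_glue L f0 f1 x) as (X & HX); trivial.
  1,2: intros p Hp; first [now apply C0 | now apply C1].
  1,2: intros p Hp; first [now apply E0 | now apply E1].
  destruct (C2_glue L g0 g1 z) as (Z & HZ); trivial.
  1,2: intros p Hp; first [now apply C0 | now apply C1].
  1,2: intros p Hp; first [now apply E0 | now apply E1].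
  exists X, Z. intros s Hs. destruct (HX s Hs), (HZ s Hs). tauto.
Qed.

(** * Surfaces of revolution in an orthonormal frame *)

Definition frame (e1 e2 e3 : vec) (p q r : R) : vec :=
  vadd (vscal p e1) (vadd (vscal q e2) (vscal r e3)).

Lemma vec_eq (p q : vec) : cx p = cx q -> cy p = cy q -> cz p = cz q -> p = q.
Proof.
  destruct p as [[p1 p2] p3], q as [[q1 q2] q3]. unfold cx, cy, cz. simpl.
  now intros -> -> ->.
Qed.

Lemma dot_frame (e1 e2 e3 : vec) (p q r p' q' r' : R) :
  orthonormal e1 e2 e3 ->
  dot (frame e1 e2 e3 p q r) (frame e1 e2 e3 p' q' r') = p * p' + q * q' + r * r'.
Proof.
  intros (H11 & H22 & H33 & H12 & H13 & H23).
  transitivity (p * p' * dot e1 e1 + q * q' * dot e2 e2 + r * r' * dot e3 e3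
    + (p * q' + q * p') * dot e1 e2 + (p * r' + r * p') * dot e1 e3
    + (q * r' + r * q') * dot e2 e3).
  - unfold frame, dot, vadd, vscal, cx, cy, cz; simpl; ring.
  - rewrite H11, H22, H33, H12, H13, H23. ring.
Qed.

Lemma dot_frame_cross (e1 e2 e3 : vec) (p q r p' q' r' p'' q'' r'' : R) :
  dot (frame e1 e2 e3 p q r)
      (cross (frame e1 e2 e3 p' q' r') (frame e1 e2 e3 p'' q'' r''))
  = (p * (q' * r'' - r' * q'') + q * (r' * p'' - p' * r'') + r * (p' * q'' - q' * p''))
    * dot e1 (cross e2 e3).
Proof. unfold frame, dot, cross, vadd, vscal, cx, cy, cz; simpl; ring. Qed.

Lemma dot_cross_cross (p q : vec) :
  dot (cross p q) (cross p q) = dot p p * dot q q - dot p q ^ 2.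
Proof. unfold dot, cross, cx, cy, cz; simpl; ring. Qed.

(** The square of a triple product is a Gram determinant, so an orthonormal
    frame has orientation [+1] or [-1]. *)
Lemma frame_orientation (e1 e2 e3 : vec) :
  orthonormal e1 e2 e3 -> Rabs (dot e1 (cross e2 e3)) = 1.
Proof.
  intros (H11 & H22 & H33 & H12 & H13 & H23).
  assert (G : dot e1 (cross e2 e3) ^ 2 =
    dot e1 e1 * (dot e2 e2 * dot e3 e3 - dot e2 e3 ^ 2)
    - dot e1 e2 * (dot e1 e2 * dot e3 e3 - dot e2 e3 * dot e1 e3)
    + dot e1 e3 * (dot e1 e2 * dot e2 e3 - dot e2 e2 * dot e1 e3))
    by (unfold dot, cross, cx, cy, cz; simpl; ring).
  rewrite H11, H22, H33, H12, H13, H23 in G.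
  rewrite <- (sqrt_pow2 (Rabs _)) by apply Rabs_pos.
  rewrite pow2_abs, G. replace (_ + _) with 1 by ring. apply sqrt_1.
Qed.

Lemma velocity_affine_frame (b e1 e2 e3 : vec) (p q r : R -> R) (t p' q' r' : R) :
  is_derive p t p' -> is_derive q t q' -> is_derive r t r' ->
  velocity (fun s => vadd b (frame e1 e2 e3 (p s) (q s) (r s))) t = frame e1 e2 e3 p' q' r'.
Proof.
  intros Hp Hq Hr.
  assert (D : forall b0 u v w : R,
    Derive (fun s => b0 + (p s * u + (q s * v + r s * w))) t = p' * u + (q' * v + r' * w)).
  { intros b0 u v w. apply is_derive_unique.
    auto_derive; [repeat split; eexists; eassumption |].
    rewrite (is_derive_unique _ _ _ Hp : Derive (fun s => p s) t = p'),
            (is_derive_unique _ _ _ Hq : Derive (fun s => q s) t = q'),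
            (is_derive_unique _ _ _ Hr : Derive (fun s => r s) t = r'). ring. }
  unfold velocity. apply vec_eq; unfold cx, cy, cz; simpl; apply D.
Qed.

Lemma velocity_frame (e1 e2 e3 : vec) (p q r : R -> R) (t p' q' r' : R) :
  is_derive p t p' -> is_derive q t q' -> is_derive r t r' ->
  velocity (fun s => frame e1 e2 e3 (p s) (q s) (r s)) t = frame e1 e2 e3 p' q' r'.
Proof.
  intros Hp Hq Hr.
  rewrite <- (velocity_affine_frame (0, 0, 0) e1 e2 e3 p q r t p' q' r') by assumption.
  unfold velocity. apply vec_eq; unfold cx, cy, cz; simpl; apply Derive_ext; intros s;
    unfold frame, vadd, vscal, cx, cy, cz; simpl; ring.
Qed.

Lemma velocity_ext_loc (c c' : R -> vec) (t : R) :
  locally t (fun s => c s = c' s) -> velocity c t = velocity c' t.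
Proof.
  intros H. unfold velocity.
  apply vec_eq; unfold cx, cy, cz; simpl; apply Derive_ext_loc; revert H;
    apply filter_imp; now intros s ->.
Qed.

Section Revolution.

Variables (b e1 e2 e3 : vec) (x z x1 z1 : R -> R).
Hypothesis He : orthonormal e1 e2 e3.

Let F := revolve b e1 e2 e3 x z.

Lemma d1_revolve (s phi : R) :
  is_derive x s (x1 s) -> is_derive z s (z1 s) ->
  d1 F s phi = frame e1 e2 e3 (x1 s * cos phi) (x1 s * sin phi) (z1 s).
Proof.
  intros Hx Hz. apply velocity_affine_frame.
  - auto_derive; [eexists; eassumption|].
    rewrite (is_derive_unique _ _ _ Hx : Derive (fun s => x s) s = x1 s). ring.
  - auto_derive; [eexists; eassumption|].
    rewrite (is_derive_unique _ _ _ Hx : Derive (fun s => x s) s = x1 s). ring.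
  - assumption.
Qed.

Lemma d2_revolve (s phi : R) :
  d2 F s phi = frame e1 e2 e3 (x s * - sin phi) (x s * cos phi) 0.
Proof.
  apply velocity_affine_frame; auto_derive; trivial; ring.
Qed.

(** The principal curvature [z' / x] along the parallels has the form [0 / 0] at the
    poles.  Multiplied by the factor [x] of the area element it leaves a density
    that makes sense there. *)
Lemma abs_mean_curvature_revolve (s phi x2 z2 : R) :
  locally s (fun r => is_derive x r (x1 r)) -> locally s (fun r => is_derive z r (z1 r)) ->
  is_derive x1 s x2 -> is_derive z1 s z2 -> 0 < x s -> x1 s ^ 2 + z1 s ^ 2 = 1 ->
  Rabs (mean_curvature F s phi) * area_density F s phi
  = Rabs (z1 s + x s * (x1 s * z2 - z1 s * x2)) / 2.
Proof.
  intros Hx Hz Hx1 Hz1 Hpos Hunit.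
  pose proof (locally_singleton _ _ Hx) as Hx0. pose proof (locally_singleton _ _ Hz) as Hz0.
  cbv beta in Hx0, Hz0.
  pose proof (sin2_cos2 phi) as Hsc. unfold Rsqr in Hsc.
  set (eps := dot e1 (cross e2 e3)).
  assert (E1 := d1_revolve s phi Hx0 Hz0).
  assert (E2 := d2_revolve s phi).
  assert (E11 : d1 (d1 F) s phi = frame e1 e2 e3 (x2 * cos phi) (x2 * sin phi) z2).
  { unfold d1 at 1. rewrite (velocity_ext_loc _
      (fun r => frame e1 e2 e3 (x1 r * cos phi) (x1 r * sin phi) (z1 r))).
    - apply velocity_frame; trivial; (auto_derive; [eexists; eassumption|]);
      rewrite (is_derive_unique _ _ _ Hx1 : Derive (fun s => x1 s) s = x2); ring.
    - generalize (filter_and _ _ Hx Hz). apply filter_imp. intros r (Hr & Hr').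
      now apply d1_revolve. }
  assert (E22 : d2 (d2 F) s phi = frame e1 e2 e3 (x s * - cos phi) (x s * - sin phi) 0).
  { unfold d2 at 1. rewrite (velocity_ext_loc _
      (fun r => frame e1 e2 e3 (x s * - sin r) (x s * cos r) 0)).
    - apply velocity_frame; auto_derive; trivial; ring.
    - apply filter_forall. intros r. apply d2_revolve. }
  assert (E12 : d1 (d2 F) s phi = frame e1 e2 e3 (x1 s * - sin phi) (x1 s * cos phi) 0).
  { unfold d1 at 1. rewrite (velocity_ext_loc _
      (fun r => frame e1 e2 e3 (x r * - sin phi) (x r * cos phi) 0)).
    - apply velocity_frame; trivial; auto_derive; try exact I; try (eexists; eassumption);
      try rewrite (is_derive_unique _ _ _ Hx0 : Derive (fun s => x s) s = x1 s); ring.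
    - apply filter_forall. intros r. apply d2_revolve. }
  assert (F11 : I11 F s phi = 1).
  { unfold I11. rewrite E1, dot_frame by exact He.
    replace (_ + _) with (x1 s ^ 2 * (sin phi * sin phi + cos phi * cos phi) + z1 s ^ 2) by ring.
    rewrite Hsc. lra. }
  assert (F12 : I12 F s phi = 0).
  { unfold I12. rewrite E1, E2, dot_frame by exact He. ring. }
  assert (F22 : I22 F s phi = x s ^ 2).
  { unfold I22. rewrite E2, dot_frame by exact He.
    replace (_ + _) with (x s ^ 2 * (sin phi * sin phi + cos phi * cos phi)) by ring.
    rewrite Hsc. ring. }
  assert (HA : vnorm (cross (d1 F s phi) (d2 F s phi)) = x s).
  { unfold vnorm. rewrite dot_cross_cross.
    change (sqrt (I11 F s phi * I22 F s phi - I12 F s phi ^ 2) = x s).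
    rewrite F11, F12, F22. rewrite <- (sqrt_pow2 (x s)) at 2 by lra. f_equal; ring. }
  assert (Hn : forall p q r, dot (frame e1 e2 e3 p q r) (normal F s phi)
    = / x s * (eps * (p * (- z1 s * x s * cos phi) + q * (- z1 s * x s * sin phi)
                      + r * (x s * x1 s)))).
  { intros p q r. unfold normal, vunit. rewrite HA.
    transitivity (/ x s * dot (frame e1 e2 e3 p q r) (cross (d1 F s phi) (d2 F s phi))).
    { unfold dot, vscal, cx, cy, cz; simpl; ring. }
    rewrite E1, E2, dot_frame_cross. fold eps.
    replace (x1 s * cos phi * (x s * cos phi) - x1 s * sin phi * (x s * - sin phi))
      with (x s * x1 s * (sin phi * sin phi + cos phi * cos phi)) by ring.
    rewrite Hsc. ring. }
  assert (S11 : II11 F s phi = eps * (x1 s * z2 - z1 s * x2)).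
  { unfold II11. rewrite E11, Hn.
    replace (x2 * cos phi * (- z1 s * x s * cos phi) + x2 * sin phi * (- z1 s * x s * sin phi))
      with (- x2 * z1 s * x s * (sin phi * sin phi + cos phi * cos phi)) by ring.
    rewrite Hsc. field. lra. }
  assert (S22 : II22 F s phi = eps * (x s * z1 s)).
  { unfold II22. rewrite E22, Hn.
    replace (x s * - cos phi * (- z1 s * x s * cos phi)
             + x s * - sin phi * (- z1 s * x s * sin phi))
      with (x s ^ 2 * z1 s * (sin phi * sin phi + cos phi * cos phi)) by ring.
    rewrite Hsc. field. lra. }
  assert (HH : mean_curvature F s phi
               = eps * (z1 s + x s * (x1 s * z2 - z1 s * x2)) * / (2 * x s)).
  { unfold mean_curvature, principal_curvature_max, principal_curvature_min.
    replace (detI F s phi) with (x s ^ 2)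
      by (unfold detI; rewrite F11, F12, F22; ring).
    replace (mixI_II F s phi) with (eps * x s * (z1 s + x s * (x1 s * z2 - z1 s * x2)))
      by (unfold mixI_II; rewrite F11, F12, F22, S11, S22; ring).
    field. lra. }
  unfold area_density. rewrite HA, HH, !Rabs_mult.
  unfold eps. rewrite frame_orientation by exact He.
  rewrite (Rabs_pos_eq (/ _)) by (left; apply Rinv_0_lt_compat; lra).
  field. lra.
Qed.

End Revolution.

(** * Integral estimates along the profile *)

Lemma continuous_sqr (f : R -> R) (s : R) :
  continuous f s -> continuous (fun t => f t ^ 2) s.
Proof.
  intros H. apply (continuous_ext (fun t => f t * f t)); [intros t; simpl; ring|].
  now apply (continuous_mult f f).
Qed.

Ltac cont :=
  cbv beta;
  match goal with
  | |- continuous (fun _ => ?c) _ => apply (continuous_const c)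
  | |- continuous (fun t => t) _ => apply continuous_id
  | |- continuous (fun t => @?f t + @?g t) _ => apply (continuous_plus f g); cont
  | |- continuous (fun t => @?f t - @?g t) _ => apply (continuous_minus f g); cont
  | |- continuous (fun t => @?f t * @?g t) _ => apply (continuous_mult f g); cont
  | |- continuous (fun t => - @?f t) _ => apply (continuous_opp f); cont
  | |- continuous (fun t => (@?f t) ^ 2) _ => apply (continuous_sqr f); cont
  | |- continuous (fun t => Rabs (@?f t)) _ =>
      apply (continuous_comp f Rabs); [cont | apply continuous_Rabs]
  | |- continuous (fun t => sqrt (@?f t)) _ =>
      apply (continuous_comp f sqrt); [cont | apply continuous_sqrt]
  | |- _ => auto
  end.

Lemma ex_RInt_closed (f : R -> R) (a b : R) :
  a <= b -> (forall t, a <= t <= b -> continuous f t) -> ex_RInt f a b.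
Proof.
  intros Hab Hf. apply (ex_RInt_continuous (V := R_CompleteNormedModule)).
  now rewrite Rmin_left, Rmax_right.
Qed.

Lemma RInt_Cauchy_Schwarz (f : R -> R) (a b : R) :
  a <= b -> (forall t, a <= t <= b -> continuous f t) ->
  RInt f a b ^ 2 <= (b - a) * RInt (fun t => f t ^ 2) a b.
Proof.
  intros Hab Hf.
  destruct (Req_dec a b) as [<-|Hn].
  { rewrite !RInt_point. unfold zero; simpl. lra. }
  assert (E1 : ex_RInt f a b) by now apply ex_RInt_closed.
  assert (E2 : ex_RInt (fun t => f t ^ 2) a b)
    by (apply ex_RInt_closed; trivial; intros; cont).
  set (A := RInt f a b : R). set (B := RInt (fun t => f t ^ 2) a b : R).
  (* The variance of [f] about its mean [m] is nonnegative. *)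
  set (m := A / (b - a)).
  assert (H : is_RInt (fun t => (f t - m) ^ 2) a b (B - 2 * m * A + m ^ 2 * (b - a))).
  { apply (is_RInt_ext (fun t => (f t ^ 2 - 2 * m * f t) + m ^ 2)).
    { intros t _. simpl; ring. }
    replace (m ^ 2 * (b - a)) with (scal (b - a) (m ^ 2))
      by (unfold scal; simpl; unfold mult; simpl; ring).
    apply (is_RInt_plus (fun t => f t ^ 2 - 2 * m * f t) (fun _ => m ^ 2));
      [|apply (is_RInt_const a b (m ^ 2))].
    apply (is_RInt_minus (fun t => f t ^ 2) (fun t => 2 * m * f t));
      [apply (RInt_correct _ _ _ E2) |].
    apply (is_RInt_scal f). apply (RInt_correct _ _ _ E1). }
  assert (H0 : 0 <= B - 2 * m * A + m ^ 2 * (b - a)).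
  { rewrite <- (is_RInt_unique _ _ _ _ H). apply RInt_ge_0; [lra | eexists; exact H |].
    intros t _. apply pow2_ge_0. }
  assert (HA : A = m * (b - a)) by (unfold m; field; lra).
  change (A ^ 2 <= (b - a) * B). rewrite HA in H0 |- *. nra.
Qed.

(** The Cauchy-Schwarz inequality for two terms, with bounds on the squares in
    place of square roots. *)
Lemma sqr_sum_le (u v p q A C : R) :
  0 <= p -> 0 <= q -> 0 <= A -> 0 <= C -> u ^ 2 <= p * A -> v ^ 2 <= q * C ->
  (u + v) ^ 2 <= (p + q) * (A + C).
Proof.
  intros Hp Hq HA HC Hu Hv.
  assert (Hc : (u * v) ^ 2 <= (p * C) * (q * A)).
  { replace ((u * v) ^ 2) with (u ^ 2 * v ^ 2) by ring.
    replace (p * C * (q * A)) with (p * A * (q * C)) by ring.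
    apply Rmult_le_compat; trivial; apply pow2_ge_0. }
  assert (2 * (u * v) <= p * C + q * A).
  { assert (0 <= p * C) by now apply Rmult_le_pos.
    assert (0 <= q * A) by now apply Rmult_le_pos.
    apply Rnot_lt_le. intros Hlt. pose proof (pow2_ge_0 (p * C - q * A)). nra. }
  nra.
Qed.

Section Profile.

Variables (L : R) (X Z : R -> R).
Hypothesis HL : 0 < L.
Hypothesis HX : forall s, 0 <= s <= L -> C2_at X s.
Hypothesis HZ : forall s, 0 <= s <= L -> C2_at Z s.
Hypothesis X0 : X 0 = 0.
Hypothesis XL : X L = 0.
Hypothesis Hunit : forall s, 0 < s < L -> Derive X s ^ 2 + Derive Z s ^ 2 = 1.

Notation X1 := (Derive X).
Notation Z1 := (Derive Z).
Notation X2 := (Derive (Derive X)).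
Notation Z2 := (Derive (Derive Z)).

Let J : R := RInt (fun s => X1 s ^ 2) 0 L.

Lemma C2_at_continuous (f : R -> R) (s : R) :
  C2_at f s -> continuous f s /\ continuous (Derive f) s.
Proof. intros (H0 & H1 & _). split; now apply (ex_derive_continuous (K := R_AbsRing) (V := R_NormedModule)). Qed.

Lemma X_continuous s : 0 <= s <= L -> continuous X s.
Proof. intros Hs. now apply C2_at_continuous, HX. Qed.
Lemma X1_continuous s : 0 <= s <= L -> continuous X1 s.
Proof. intros Hs. now apply C2_at_continuous, HX. Qed.
Lemma X2_continuous s : 0 <= s <= L -> continuous X2 s.
Proof. intros Hs. now apply HX. Qed.
Lemma Z1_continuous s : 0 <= s <= L -> continuous Z1 s.
Proof. intros Hs. now apply C2_at_continuous, HZ. Qed.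
Lemma Z2_continuous s : 0 <= s <= L -> continuous Z2 s.
Proof. intros Hs. now apply HZ. Qed.

Local Hint Resolve X_continuous X1_continuous X2_continuous Z1_continuous Z2_continuous : core.

Lemma acceleration_orthogonal s : 0 < s < L -> X1 s * X2 s + Z1 s * Z2 s = 0.
Proof.
  intros Hs. destruct (HX s) as (_ & HX1 & _); [lra|]. destruct (HZ s) as (_ & HZ1 & _); [lra|].
  apply Derive_correct in HX1, HZ1.
  assert (H : is_derive (fun r => X1 r * X1 r + Z1 r * Z1 r) s
                        (X2 s * X1 s + X1 s * X2 s + (Z2 s * Z1 s + Z1 s * Z2 s))).
  { apply (is_derive_plus (fun r => X1 r * X1 r) (fun r => Z1 r * Z1 r));
      apply (is_derive_mult (K := R_AbsRing)); trivial; intros; apply Rmult_comm. }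
  assert (H' : is_derive (fun r => X1 r * X1 r + Z1 r * Z1 r) s 0).
  { apply (is_derive_ext_loc (fun _ => 1)); [|apply (is_derive_const (1 : R))].
    apply (locally_interval 0 L); [exact Hs|]. intros t Ht. rewrite <- (Hunit t Ht).
    simpl; ring. }
  apply is_derive_unique in H. apply is_derive_unique in H'. lra.
Qed.

(** Up to orientation, twice the mean curvature times the radius.  The curvature
    [theta'] of the profile appears as [x' z'' - z' x''], which involves no angle
    function. *)
Definition mean_density (s : R) : R := Z1 s + X s * (X1 s * Z2 s - Z1 s * X2 s).

Lemma mean_density_continuous s : 0 <= s <= L -> continuous mean_density s.
Proof. intros Hs. unfold mean_density. cont. Qed.

(** The calibration: with [g = z' (1 + x'^2 / 2)] and [P = x (x' + x'^3 / 6)] the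
    terms containing second derivatives cancel in [h g + P'], which becomes
    [1 + x'^2 / 2 - x'^4 / 3 >= 1 + x'^2 / 6].  The parenthesis below is [P']. *)
Lemma abs_mean_density_ge s : 0 < s < L ->
  1 + / 6 * X1 s ^ 2
    - (X1 s * (X1 s + / 6 * (X1 s * X1 s ^ 2)) + X s * (X2 s * (1 + / 2 * X1 s ^ 2)))
  <= Rabs (mean_density s).
Proof.
  intros Hs. pose proof (Hunit s Hs) as Hu. pose proof (acceleration_orthogonal s Hs) as Ho.
  set (g := Z1 s * (1 + / 2 * X1 s ^ 2)).
  assert (Hg : Rabs g <= 1).
  { assert (g ^ 2 <= 1).
    { unfold g. replace ((Z1 s * (1 + / 2 * X1 s ^ 2)) ^ 2)
        with (Z1 s ^ 2 * (1 + / 2 * X1 s ^ 2) ^ 2) by ring.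
      replace (Z1 s ^ 2) with (1 - X1 s ^ 2) by lra.
      pose proof (pow2_ge_0 (X1 s)). set (w := X1 s ^ 2) in *. nra. }
    apply Rabs_le. nra. }
  apply Rle_trans with (mean_density s * g).
  - assert (E : mean_density s * g
      + (X1 s * (X1 s + / 6 * (X1 s * X1 s ^ 2)) + X s * (X2 s * (1 + / 2 * X1 s ^ 2)))
      = 1 + / 2 * X1 s ^ 2 - / 3 * (X1 s ^ 2) ^ 2).
    { unfold mean_density, g.
      transitivity (Z1 s ^ 2 * (1 + / 2 * X1 s ^ 2) + X1 s ^ 2 + / 6 * (X1 s ^ 2) ^ 2
        + X s * (1 + / 2 * X1 s ^ 2)
          * (X1 s * (X1 s * X2 s + Z1 s * Z2 s) + X2 s * (1 - (X1 s ^ 2 + Z1 s ^ 2)))).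
      - ring.
      - rewrite Ho, Hu. replace (Z1 s ^ 2) with (1 - X1 s ^ 2) by lra. field. }
    pose proof (pow2_ge_0 (X1 s)). pose proof (pow2_ge_0 (Z1 s)).
    set (w := X1 s ^ 2) in *. nra.
  - apply Rle_trans with (1 := Rle_abs _). rewrite Rabs_mult.
    pose proof (Rabs_pos (mean_density s)). nra.
Qed.

Lemma RInt_abs_mean_density_ge :
  L + / 6 * J <= RInt (fun s => Rabs (mean_density s)) 0 L.
Proof.
  set (P := fun s => X s * (X1 s + / 6 * (X1 s * X1 s ^ 2))).
  set (P1 := fun s => X1 s * (X1 s + / 6 * (X1 s * X1 s ^ 2))
                      + X s * (X2 s * (1 + / 2 * X1 s ^ 2))).
  assert (HP : is_RInt P1 0 L 0).
  { replace 0 with (minus (P L) (P 0)) at 2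
      by (unfold P, minus, plus, opp; simpl; rewrite X0, XL; ring).
    apply (is_RInt_derive P P1); rewrite Rmin_left, Rmax_right by lra; intros s Hs.
    - destruct (HX s Hs) as (H0 & H1 & _). apply Derive_correct in H0, H1.
      unfold P, P1. apply (is_derive_mult (K := R_AbsRing) X (fun t => X1 t + / 6 * (X1 t * X1 t ^ 2))); trivial.
      2: intros; apply Rmult_comm.
      replace (X2 s * (1 + / 2 * X1 s ^ 2))
        with (X2 s + / 6 * (X2 s * X1 s ^ 2 + X1 s * (2 * X2 s * X1 s))) by field.
      apply (is_derive_plus X1 (fun t => / 6 * (X1 t * X1 t ^ 2))); trivial.
      apply (is_derive_scal (fun t => X1 t * X1 t ^ 2)).
      apply (is_derive_mult (K := R_AbsRing) X1 (fun t => X1 t ^ 2)); trivial.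
      2: intros; apply Rmult_comm.
      replace (2 * X2 s * X1 s) with (INR 2 * X2 s * X1 s ^ 1) by (simpl; ring).
      now apply (is_derive_pow X1 2).
    - unfold P1. cont. }
  assert (EJ : ex_RInt (fun s => X1 s ^ 2) 0 L).
  { apply ex_RInt_closed; [lra|]. intros; cont. }
  assert (H : is_RInt (fun s => 1 + / 6 * X1 s ^ 2 - P1 s) 0 L (L + / 6 * J - 0)).
  { apply (is_RInt_minus (fun s => 1 + / 6 * X1 s ^ 2) P1); [|exact HP].
    replace L with (scal (L - 0) 1) at 2 by (unfold scal; simpl; unfold mult; simpl; ring).
    apply (is_RInt_plus (fun _ => 1) (fun s => / 6 * X1 s ^ 2));
      [apply (is_RInt_const 0 L (1 : R))|].
    apply (is_RInt_scal (fun s => X1 s ^ 2)). apply (RInt_correct _ _ _ EJ). }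
  replace (L + / 6 * J) with (L + / 6 * J - 0) by ring.
  rewrite <- (is_RInt_unique _ _ _ _ H).
  apply RInt_le; [lra | eexists; exact H | |].
  - apply ex_RInt_closed; [lra|]. intros s Hs.
    apply (continuous_comp mean_density Rabs);
      [now apply mean_density_continuous | apply continuous_Rabs].
  - intros s Hs. now apply abs_mean_density_ge.
Qed.

Lemma coordinate_lipschitz (f : R -> R) s t :
  (forall r, 0 <= r <= L -> C2_at f r) -> (forall r, 0 < r < L -> Derive f r ^ 2 <= 1) ->
  0 <= s -> s <= t -> t <= L -> Rabs (f t - f s) <= t - s.
Proof.
  intros Hf Hf1 Hs Hst Ht.
  destruct (Req_dec s t) as [<-|Hn].
  { rewrite !Rminus_diag, Rabs_R0. lra. }
  destruct (MVT_cor2 f (Derive f) s t) as (r & Er & Hr); [lra| |].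
  { intros r Hr. apply is_derive_Reals, Derive_correct, Hf. lra. }
  rewrite Er, Rabs_mult, (Rabs_pos_eq (t - s)) by lra.
  assert (Rabs (Derive f r) <= 1).
  { pose proof (Hf1 r ltac:(lra)). apply Rabs_le. nra. }
  nra.
Qed.

Lemma height_lipschitz s t : 0 <= s -> s <= t -> t <= L -> Rabs (Z t - Z s) <= t - s.
Proof.
  apply coordinate_lipschitz; trivial. intros r Hr.
  pose proof (Hunit r Hr). pose proof (pow2_ge_0 (X1 r)). lra.
Qed.

Lemma radius_lipschitz s t : 0 <= s -> s <= t -> t <= L -> Rabs (X t - X s) <= t - s.
Proof.
  apply coordinate_lipschitz; trivial. intros r Hr.
  pose proof (Hunit r Hr). pose proof (pow2_ge_0 (Z1 r)). lra.
Qed.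

Lemma sqr_increment_le s t : 0 <= s -> s <= t -> t <= L ->
  (X t - X s) ^ 2 <= (t - s) * RInt (fun r => X1 r ^ 2) s t.
Proof.
  intros Hs Hst Ht. rewrite <- (RInt_Derive X).
  - apply RInt_Cauchy_Schwarz; trivial. intros r Hr. apply X1_continuous. lra.
  - rewrite Rmin_left, Rmax_right by trivial. intros r Hr. apply HX. lra.
  - rewrite Rmin_left, Rmax_right by trivial. intros r Hr. apply X1_continuous. lra.
Qed.

(** The radii at [s] and [t] are reached from the two poles along disjoint arcs, so
    both draw on the same [J] without counting any part of it twice. *)
Lemma sqr_radii_sum_le s t : 0 <= s -> s <= t -> t <= L -> (X s + X t) ^ 2 <= L * J.
Proof.
  intros Hs Hst Ht.
  assert (EI : forall a b, 0 <= a -> a <= b -> b <= L -> ex_RInt (fun r => X1 r ^ 2) a b).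
  { intros a b Ha Hab Hb. apply ex_RInt_closed; [lra|].
    intros r Hr. apply continuous_sqr, X1_continuous. lra. }
  assert (PI : forall a b, 0 <= a -> a <= b -> b <= L -> 0 <= RInt (fun r => X1 r ^ 2) a b).
  { intros a b Ha Hab Hb. apply RInt_ge_0; auto. intros; apply pow2_ge_0. }
  pose proof (sqr_increment_le 0 s ltac:(lra) ltac:(lra) ltac:(lra)) as H1.
  pose proof (sqr_increment_le t L ltac:(lra) ltac:(lra) ltac:(lra)) as H2.
  rewrite X0 in H1. rewrite XL in H2.
  assert (HJ : J = RInt (fun r => X1 r ^ 2) 0 s + RInt (fun r => X1 r ^ 2) s t
                   + RInt (fun r => X1 r ^ 2) t L).
  { unfold J. rewrite <- (RInt_Chasles _ 0 t L), <- (RInt_Chasles _ 0 s t) by (apply EI; lra).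
    reflexivity. }
  pose proof (PI 0 s ltac:(lra) ltac:(lra) ltac:(lra)) as P1.
  pose proof (PI s t ltac:(lra) ltac:(lra) ltac:(lra)) as P2.
  pose proof (PI t L ltac:(lra) ltac:(lra) ltac:(lra)) as P3.
  set (A := RInt _ 0 s) in *. set (B := RInt _ s t) in *. set (C := RInt _ t L) in *.
  rewrite HJ.
  apply Rle_trans with ((s + (L - t)) * (A + C)); [|apply Rmult_le_compat; lra].
  apply sqr_sum_le; trivial; lra.
Qed.

(** With [m = t - s] the heights differ by at most [m] and the radii add up to at
    most [L - m], and [m^2 + (L - m)^2 <= L^2]. *)
Lemma separation_le s t d : 0 <= s -> s <= t -> t <= L ->
  d ^ 2 <= (X s + X t) ^ 2 + (Z s - Z t) ^ 2 -> d <= L.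
Proof.
  intros Hs Hst Ht Hd.
  pose proof (radius_lipschitz 0 s ltac:(lra) ltac:(lra) ltac:(lra)) as H1.
  pose proof (height_lipschitz s t ltac:(lra) ltac:(lra) ltac:(lra)) as H2.
  pose proof (radius_lipschitz t L ltac:(lra) ltac:(lra) ltac:(lra)) as H3.
  rewrite X0 in H1. rewrite XL in H3.
  apply Rabs_le_between in H1, H2, H3.
  assert (Hx : (X s + X t) ^ 2 <= (L - (t - s)) ^ 2) by (apply pow_maj_Rabs, Rabs_le; lra).
  assert (Hz : (Z s - Z t) ^ 2 <= (t - s) ^ 2) by (apply pow_maj_Rabs, Rabs_le; lra).
  apply Rnot_lt_le. intros Hlt.
  assert (0 <= (t - s) * (L - (t - s))) by (apply Rmult_le_pos; lra).
  nra.
Qed.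

Hypothesis Z0 : Z 0 = 0.
Hypothesis ZL : 0 <= Z L.

(** Let [w] be the difference of the heights at [s] and [t].  Since [w <= L],
    [d^2 <= L (w + J)], and [2 L d <= L^2 + d^2] gives [L - w <= 2 (L - d) + J].
    The rest of the profile has length at most [L - w], so [Z L] differs from
    [w] or from [- w] by at most [L - w]; in the second case [Z L >= 0] forces
    [w <= L / 2].  Either way [L - Z L <= 2 (L - w)]. *)
Lemma height_defect_le s t d : 0 <= s -> s <= t -> t <= L ->
  d ^ 2 <= (X s + X t) ^ 2 + (Z s - Z t) ^ 2 ->
  L - Z L <= 4 * (L - d) + 2 * J.
Proof.
  intros Hs Hst Ht Hd.
  pose proof (sqr_radii_sum_le s t Hs Hst Ht) as HXX.
  pose proof (height_lipschitz 0 s ltac:(lra) ltac:(lra) ltac:(lra)) as H1.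
  pose proof (height_lipschitz s t ltac:(lra) ltac:(lra) ltac:(lra)) as H2.
  pose proof (height_lipschitz t L ltac:(lra) ltac:(lra) ltac:(lra)) as H3.
  rewrite Z0 in H1.
  set (w := Rabs (Z t - Z s)) in *.
  assert (Hw : (Z s - Z t) ^ 2 = w ^ 2).
  { unfold w. rewrite pow2_abs. ring. }
  assert (Hw0 : 0 <= w) by apply Rabs_pos.
  assert (HLw : L - w <= 2 * (L - d) + J).
  { apply Rmult_le_reg_l with L; [lra|].
    pose proof (pow2_ge_0 (L - d)). nra. }
  apply Rle_trans with (2 * (L - w)); [|lra].
  apply Rabs_le_between in H1, H3.
  unfold w in *. revert H2 HLw Hw Hw0. unfold Rabs. destruct (Rcase_abs (Z t - Z s)); lra.
Qed.

End Profile.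

(** * Curves in polar coordinates and the quantity [U] *)

Lemma vnorm_sqr (p : vec) : vnorm p ^ 2 = dot p p.
Proof.
  unfold vnorm. apply pow2_sqrt. unfold dot.
  pose proof (pow2_ge_0 (cx p)). pose proof (pow2_ge_0 (cy p)). pose proof (pow2_ge_0 (cz p)). nra.
Qed.

Lemma vnorm_nonneg (p : vec) : 0 <= vnorm p.
Proof. apply sqrt_pos. Qed.

Lemma dot_vscal_l (k : R) (p q : vec) : dot (vscal k p) q = k * dot p q.
Proof. unfold dot, vscal, cx, cy, cz; simpl; ring. Qed.

Lemma vsub_revolve (b e1 e2 e3 : vec) (x z : R -> R) (s phi t psi : R) :
  vsub (revolve b e1 e2 e3 x z s phi) (revolve b e1 e2 e3 x z t psi)
  = frame e1 e2 e3 (x s * cos phi - x t * cos psi) (x s * sin phi - x t * sin psi) (z s - z t).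
Proof.
  apply vec_eq; unfold vsub, revolve, frame, vadd, vscal, cx, cy, cz; simpl; ring.
Qed.

Lemma distance_revolve_le (b e1 e2 e3 : vec) (x z : R -> R) (s phi t psi : R) :
  orthonormal e1 e2 e3 -> 0 <= x s -> 0 <= x t ->
  vnorm (vsub (revolve b e1 e2 e3 x z s phi) (revolve b e1 e2 e3 x z t psi)) ^ 2
  <= (x s + x t) ^ 2 + (z s - z t) ^ 2.
Proof.
  intros He Hs Ht. rewrite vnorm_sqr, vsub_revolve, dot_frame by exact He.
  pose proof (sin2_cos2 phi) as H1. pose proof (sin2_cos2 psi) as H2. unfold Rsqr in H1, H2.
  pose proof (COS_bound (phi - psi)) as H3. rewrite cos_minus in H3.
  assert (0 <= x s * x t * (1 + (cos phi * cos psi + sin phi * sin psi))).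
  { apply Rmult_le_pos; [now apply Rmult_le_pos | lra]. }
  match goal with |- ?a <= ?c => assert (c - a =
    x s ^ 2 * (1 - (sin phi * sin phi + cos phi * cos phi))
    + x t ^ 2 * (1 - (sin psi * sin psi + cos psi * cos psi))
    + 2 * (x s * x t * (1 + (cos phi * cos psi + sin phi * sin psi)))) as E by ring end.
  rewrite H1, H2 in E. lra.
Qed.

Lemma velocity_polar (b e1 e2 e3 : vec) (x z s th : R -> R) (c : R -> vec)
    (t xd zd sd thd : R) :
  is_derive x (s t) xd -> is_derive z (s t) zd ->
  is_derive s t sd -> is_derive th t thd ->
  locally t (fun r => c r = revolve b e1 e2 e3 x z (s r) (th r)) ->
  velocity c t = frame e1 e2 e3
    (xd * sd * cos (th t) - x (s t) * (sin (th t) * thd))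
    (xd * sd * sin (th t) + x (s t) * (cos (th t) * thd)) (zd * sd).
Proof.
  intros Hx Hz Hs Hth Hc.
  rewrite (velocity_ext_loc _ _ _ Hc).
  assert (Hxs : is_derive (fun r => x (s r)) t (xd * sd)).
  { rewrite Rmult_comm. exact (is_derive_comp x s t xd sd Hx Hs). }
  assert (Hzs : is_derive (fun r => z (s r)) t (zd * sd)).
  { rewrite Rmult_comm. exact (is_derive_comp z s t zd sd Hz Hs). }
  assert (Hcos : is_derive (fun r => cos (th r)) t (- sin (th t) * thd)).
  { rewrite Rmult_comm. exact (is_derive_comp cos th t _ thd (is_derive_cos _) Hth). }
  assert (Hsin : is_derive (fun r => sin (th r)) t (cos (th t) * thd)).
  { rewrite Rmult_comm. exact (is_derive_comp sin th t _ thd (is_derive_sin _) Hth). }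
  apply velocity_affine_frame; [| |exact Hzs].
  - replace (_ - _) with (xd * sd * cos (th t) + x (s t) * (- sin (th t) * thd)) by ring.
    apply (is_derive_mult (K := R_AbsRing) (fun r => x (s r)) (fun r => cos (th r)));
      trivial; intros; apply Rmult_comm.
  - apply (is_derive_mult (K := R_AbsRing) (fun r => x (s r)) (fun r => sin (th r)));
      trivial; intros; apply Rmult_comm.
Qed.

Lemma dot_velocity_polar (e1 e2 e3 : vec) (xs xd zd sd th thd : R) :
  orthonormal e1 e2 e3 -> xd ^ 2 + zd ^ 2 = 1 ->
  let w := frame e1 e2 e3 (xd * sd * cos th - xs * (sin th * thd))
             (xd * sd * sin th + xs * (cos th * thd)) (zd * sd) in
  dot w w = sd ^ 2 + (xs * thd) ^ 2.
Proof.
  intros He Hu w. unfold w. rewrite dot_frame by exact He.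
  pose proof (sin2_cos2 th) as H. unfold Rsqr in H.
  transitivity (((xd * sd) ^ 2 + (xs * thd) ^ 2) * (sin th * sin th + cos th * cos th)
                + zd ^ 2 * sd ^ 2); [ring|].
  rewrite H. replace (zd ^ 2) with (1 - xd ^ 2) by lra. ring.
Qed.

Section Geodesic.

Variables (L : R) (x z X Z : R -> R) (b e1 e2 e3 : vec).
Hypothesis HL : 0 < L.
Hypothesis He : orthonormal e1 e2 e3.
Hypothesis HX : forall s, 0 <= s <= L -> C2_at X s.
Hypothesis HZ : forall s, 0 <= s <= L -> C2_at Z s.
Hypothesis EX : forall s, 0 <= s <= L -> X s = x s.
Hypothesis EZ : forall s, 0 <= s <= L -> Z s = z s.
Hypothesis X0 : X 0 = 0.
Hypothesis XL : X L = 0.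
Hypothesis Z0 : Z 0 = 0.
Hypothesis ZL : 0 <= Z L.
Hypothesis Hunit : forall s, 0 < s < L -> Derive X s ^ 2 + Derive Z s ^ 2 = 1.

Let F := revolve b e1 e2 e3 x z.

Lemma profile_derivatives s : 0 < s < L ->
  is_derive x s (Derive X s) /\ is_derive z s (Derive Z s).
Proof.
  intros Hs. split.
  - apply (is_derive_ext_loc X).
    + apply (locally_interval 0 L); [exact Hs|]. intros t Ht. apply EX. lra.
    + apply Derive_correct, HX. lra.
  - apply (is_derive_ext_loc Z).
    + apply (locally_interval 0 L); [exact Hs|]. intros t Ht. apply EZ. lra.
    + apply Derive_correct, HZ. lra.
Qed.

Lemma meridian_is_curve : pole_to_pole_curve L F (fun t => F (L * t) 0).
Proof.
  exists (fun t => L * t), (fun _ => 0). repeat split.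
  - auto_derive; trivial.
  - apply (continuous_ext (fun _ => L)); [|apply continuous_const].
    intros r. symmetry. apply is_derive_unique. auto_derive; trivial; ring.
  - auto_derive; trivial.
  - apply (continuous_ext (fun _ => 0)); [|apply continuous_const].
    intros r. symmetry. apply is_derive_unique. auto_derive; trivial; ring.
  - nra.
  - nra.
  - left. split; ring.
Qed.

Lemma meridian_length : curve_length (fun t => F (L * t) 0) = L.
Proof.
  unfold curve_length.
  transitivity (RInt (fun _ => L) 0 1).
  - apply RInt_ext. rewrite Rmin_left, Rmax_right by lra. intros t Ht.
    assert (Hs : 0 < L * t < L) by nra.
    destruct (profile_derivatives _ Hs) as (Hx & Hz).
    rewrite (velocity_polar b e1 e2 e3 x z (fun t => L * t) (fun _ => 0) _ t
      (Derive X (L * t)) (Derive Z (L * t)) L 0); trivial.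
    + unfold vnorm. rewrite dot_velocity_polar by auto.
      rewrite <- (sqrt_pow2 L) by lra. f_equal. rewrite (sqrt_pow2 L) by lra. ring.
    + auto_derive; trivial; ring.
    + auto_derive; trivial; ring.
    + apply filter_forall. reflexivity.
  - rewrite RInt_const. unfold scal; simpl; unfold mult; simpl. ring.
Qed.

(** [real] sends an infinite supremum to [0]; the hypotheses exclude that case. *)
Lemma Lub_Rbar_between (E : R -> Prop) (d0 B : R) :
  E d0 -> (forall d, E d -> d <= B) -> d0 <= real (Lub_Rbar E) <= B.
Proof.
  intros H0 HB. destruct (Lub_Rbar_correct E) as (Hub & Hl).
  specialize (Hub d0 H0). specialize (Hl (Finite B) HB).
  destruct (Lub_Rbar E); simpl in *; easy.
Qed.

(** Comparison with the meridian bounds the speed [v] of [c] by [L], and the mean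
    value theorem for the polar coordinate [s] bounds it below by [L].  So the
    mean of [1 - T . omega] is [1 - (c 1 - c 0) . omega / L], which depends on the
    poles alone, and it dominates [U] by the Cauchy-Schwarz inequality. *)
Lemma U_le (omega : vec) (c : R -> vec) :
  admissible L F e3 omega c -> U omega c <= 1 - Z L / L.
Proof.
  intros (Hom & (a & Ha) & (Hc & (v & Hv) & Hmin) & (lambda & Hlam & Hend)).
  pose proof (Hmin _ meridian_is_curve) as Hlen. rewrite meridian_length in Hlen.
  destruct Hc as (s & th & Cs & Cth & Hin & Hpole & Hc).
  assert (Hvdef : curve_length c = v).
  { unfold curve_length. transitivity (RInt (fun _ => v) 0 1).
    - apply RInt_ext. rewrite Rmin_left, Rmax_right by lra. exact Hv.
    - rewrite RInt_const. unfold scal; simpl; unfold mult; simpl. ring. }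
  rewrite Hvdef in Hlen.
  pose proof He as (_ & _ & H33 & _ & _ & _).
  assert (Ha2 : a ^ 2 = 1).
  { assert (H : vnorm omega ^ 2 = 1) by (rewrite Hom; ring).
    rewrite vnorm_sqr, Ha in H.
    transitivity (a ^ 2 * dot e3 e3); [rewrite H33; ring|].
    rewrite <- H. unfold dot, vscal, cx, cy, cz; simpl; ring. }
  (* The rate of change of the height along [c]. *)
  set (r' := fun t => Derive Z (s t) * Derive s t).
  assert (Hvel : forall t, 0 < t < 1 ->
    dot (velocity c t) (velocity c t) = Derive s t ^ 2 + (x (s t) * Derive th t) ^ 2 /\
    dot (velocity c t) omega = a * r' t /\ r' t ^ 2 <= dot (velocity c t) (velocity c t)).
  { intros t Ht. pose proof (Hin t Ht) as Hst.
    destruct (profile_derivatives _ Hst) as (Hx & Hz).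
    rewrite (velocity_polar b e1 e2 e3 x z s th c t
      (Derive X (s t)) (Derive Z (s t)) (Derive s t) (Derive th t)); trivial.
    - rewrite dot_velocity_polar by auto. split; [reflexivity | split].
      + rewrite Ha.
        transitivity (a * dot
          (frame e1 e2 e3
            (Derive X (s t) * Derive s t * cos (th t) - x (s t) * (sin (th t) * Derive th t))
            (Derive X (s t) * Derive s t * sin (th t) + x (s t) * (cos (th t) * Derive th t))
            (Derive Z (s t) * Derive s t))
          (frame e1 e2 e3 0 0 1)).
        * unfold frame, dot, vadd, vscal, cx, cy, cz; simpl; ring.
        * rewrite dot_frame by exact He. unfold r'. ring.
      + unfold r'. rewrite Rpow_mult_distr.
        pose proof (Hunit _ Hst). pose proof (pow2_ge_0 (Derive X (s t))).
        pose proof (pow2_ge_0 (Derive s t)). pose proof (pow2_ge_0 (x (s t) * Derive th t)).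
        nra.
    - apply Derive_correct, Cs. lra.
    - apply Derive_correct, Cth. lra.
    - apply (locally_interval 0 1); [exact Ht|]. intros r Hr. apply Hc. lra. }
  (* Some [t] has [|s' t| = L], and the speed is at least [|s'|]. *)
  assert (HvL : v = L).
  { apply Rle_antisym; [exact Hlen|].
    destruct (MVT_cor2 s (Derive s) 0 1) as (t & Et & Ht); [lra| |].
    { intros t Ht. apply is_derive_Reals, Derive_correct, Cs, Ht. }
    destruct (Hvel t Ht) as (Hd & _). rewrite <- vnorm_sqr, (Hv t Ht) in Hd.
    pose proof (vnorm_nonneg (velocity c t)) as Hv0. rewrite (Hv t Ht) in Hv0.
    assert (Derive s t ^ 2 = L ^ 2).
    { replace (Derive s t) with (s 1 - s 0) by lra.
      destruct Hpole as [(-> & ->)|(-> & ->)]; ring. }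
    pose proof (pow2_ge_0 (x (s t) * Derive th t)). nra. }
  clear Hvdef Hlen. subst v.
  assert (Hs01 : forall t, 0 <= t <= 1 -> 0 <= s t <= L).
  { intros t Ht. destruct (Req_dec t 0) as [->|]; [lra|].
    destruct (Req_dec t 1) as [->|]; [lra|]. pose proof (Hin t ltac:(lra)). lra. }
  assert (Hrise : a * (Z (s 1) - Z (s 0)) = Z L).
  { rewrite !Hc in Hend by lra.
    assert (Hax : x (s 1) = 0 /\ x (s 0) = 0).
    { rewrite <- !EX by (apply Hs01; lra).
      destruct Hpole as [(-> & ->)|(-> & ->)]; now split. }
    destruct Hax as (Hx1 & Hx0).
    unfold F in Hend. rewrite vsub_revolve, Hx1, Hx0, Ha in Hend.
    assert (Hz : z (s 1) - z (s 0) = lambda * a).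
    { transitivity (dot (frame e1 e2 e3 (0 * cos (th 1) - 0 * cos (th 0))
         (0 * sin (th 1) - 0 * sin (th 0)) (z (s 1) - z (s 0))) (frame e1 e2 e3 0 0 1)).
      - rewrite dot_frame by exact He. ring.
      - rewrite Hend. transitivity (lambda * a * dot e3 (frame e1 e2 e3 0 0 1)).
        + unfold frame, dot, vadd, vscal, cx, cy, cz; simpl; ring.
        + transitivity (lambda * a * dot (frame e1 e2 e3 0 0 1) (frame e1 e2 e3 0 0 1)).
          * unfold frame, dot, vadd, vscal, cx, cy, cz; simpl; ring.
          * rewrite dot_frame by exact He. ring. }
    rewrite <- !EZ in Hz by (apply Hs01; lra).
    rewrite Hz. transitivity (a ^ 2 * lambda); [ring|]. rewrite Ha2.
    assert (lambda ^ 2 = Z L ^ 2).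
    { transitivity (a ^ 2 * lambda ^ 2); [rewrite Ha2; ring|].
      transitivity ((lambda * a) ^ 2); [ring|]. rewrite <- Hz.
      destruct Hpole as [(-> & ->)|(-> & ->)]; rewrite Z0; ring. }
    nra. }
  assert (Cr : forall t, 0 <= t <= 1 -> continuous r' t).
  { intros t Ht. unfold r'. apply (continuous_mult (fun t => Derive Z (s t)) (Derive s)).
    - apply (continuous_comp s (Derive Z)).
      + apply (ex_derive_continuous (K := R_AbsRing) (V := R_NormedModule)), Cs, Ht.
      + apply C2_at_continuous, HZ, Hs01, Ht.
    - apply Cs, Ht. }
  assert (Ir : is_RInt r' 0 1 (Z (s 1) - Z (s 0))).
  { apply (is_RInt_derive (fun t => Z (s t)) r'); rewrite Rmin_left, Rmax_right by lra;
      [|exact Cr].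
    intros t Ht. unfold r'. rewrite Rmult_comm.
    apply (is_derive_comp Z s); apply Derive_correct; [apply HZ, Hs01, Ht | apply Cs, Ht]. }
  set (f := fun t => sqrt (1 - a / L * r' t)).
  assert (Cf : forall t, 0 <= t <= 1 -> continuous f t) by (intros; unfold f; cont).
  unfold U.
  rewrite (RInt_ext _ f).
  2: { rewrite Rmin_left, Rmax_right by lra. intros t Ht. unfold f. f_equal. f_equal.
       unfold vunit. rewrite (Hv t Ht).
       destruct (Hvel t Ht) as (_ & Hd & _).
       rewrite dot_vscal_l, Hd. field. lra. }
  apply Rle_trans with (1 := RInt_Cauchy_Schwarz f 0 1 ltac:(lra) Cf).
  replace (1 - 0) with 1 by ring. rewrite Rmult_1_l. apply Req_le.
  rewrite (RInt_ext _ (fun t => 1 - a / L * r' t)).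
  2: { rewrite Rmin_left, Rmax_right by lra. intros t Ht. unfold f. apply pow2_sqrt.
       destruct (Hvel t Ht) as (_ & _ & Hd). rewrite <- vnorm_sqr, (Hv t Ht) in Hd.
       assert (a * r' t <= L).
       { assert ((a * r' t) ^ 2 <= L ^ 2) by (rewrite Rpow_mult_distr, Ha2; lra). nra. }
       replace (1 - a / L * r' t) with ((L - a * r' t) * / L) by (field; lra).
       apply Rmult_le_pos; [lra | left; now apply Rinv_0_lt_compat]. }
  assert (I : is_RInt (fun t => 1 - a / L * r' t) 0 1
                (scal (1 - 0) 1 - a / L * (Z (s 1) - Z (s 0)))).
  { apply (is_RInt_minus (fun _ => 1) (fun t => a / L * r' t)).
    - apply (is_RInt_const 0 1 (1 : R)).
    - apply (is_RInt_scal r'), Ir. }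
  rewrite (is_RInt_unique _ _ _ _ I). unfold scal; simpl; unfold mult; simpl.
  rewrite <- Hrise. field. lra.
Qed.

(** * The diameter and the total mean curvature *)

Hypothesis Hpos : forall s, 0 < s < L -> 0 < x s.

Lemma distance_bounds p q :
  surface L F p -> surface L F q ->
  vnorm (vsub p q) <= L /\
  L - Z L <= 4 * (L - vnorm (vsub p q)) + 2 * RInt (fun s => Derive X s ^ 2) 0 L.
Proof.
  assert (Hx : forall s, 0 <= s <= L -> 0 <= x s).
  { intros s Hs. destruct (Req_dec s 0) as [->|]; [rewrite <- EX; lra|].
    destruct (Req_dec s L) as [->|]; [rewrite <- EX; lra|].
    left. apply Hpos. lra. }
  intros (s & phi & Hs & _ & ->) (t & psi & Ht & _ & ->).
  pose proof (distance_revolve_le b e1 e2 e3 x z s phi t psi He (Hx s Hs) (Hx t Ht)) as Hd.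
  fold F in Hd. rewrite <- !EX, <- !EZ in Hd by trivial.
  destruct (Rle_lt_dec s t) as [Hst|Hst].
  - split.
    + apply (separation_le L X Z) with (s := s) (t := t); trivial; lra.
    + apply (height_defect_le L X Z) with (s := s) (t := t); trivial; lra.
  - replace ((X s + X t) ^ 2) with ((X t + X s) ^ 2) in Hd by ring.
    replace ((Z s - Z t) ^ 2) with ((Z t - Z s) ^ 2) in Hd by ring.
    split.
    + apply (separation_le L X Z) with (s := t) (t := s); trivial; lra.
    + apply (height_defect_le L X Z) with (s := t) (t := s); trivial; lra.
Qed.

Lemma diameter_bounds :
  let D := diameter (surface L F) in
  0 < D /\ D <= L /\
  L - Z L <= 4 * (L - D) + 2 * RInt (fun s => Derive X s ^ 2) 0 L.
Proof.
  intros D. set (J := RInt (fun s => Derive X s ^ 2) 0 L : R).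
  (* Two distinct points, to bound the diameter away from [0]. *)
  set (p := F (L / 2) 0). set (q := F 0 0).
  assert (Hp : surface L F p).
  { exists (L / 2), 0. pose proof PI_RGT_0. repeat split; lra. }
  assert (Hq : surface L F q).
  { exists 0, 0. pose proof PI_RGT_0. repeat split; lra. }
  assert (Hpq : 0 < vnorm (vsub p q)).
  { apply sqrt_lt_R0. unfold p, q, F. rewrite vsub_revolve, dot_frame by exact He.
    rewrite <- (EX 0), X0, cos_0, sin_0 by lra.
    pose proof (pow_lt _ 2 (Hpos (L / 2) ltac:(lra))).
    pose proof (pow2_ge_0 (z (L / 2) - z 0)). lra. }
  assert (HD : forall B, (forall p q, surface L F p -> surface L F q -> vnorm (vsub p q) <= B) ->
    vnorm (vsub p q) <= D <= B).
  { intros B HB. apply Lub_Rbar_between; [now exists p, q|].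
    intros d (p' & q' & Hp' & Hq' & ->). now apply HB. }
  destruct (HD L) as (HD0 & HDL).
  { intros p' q' Hp' Hq'. now apply distance_bounds. }
  destruct (HD (L - (L - Z L - 2 * J) / 4)) as (_ & HDJ).
  { intros p' q' Hp' Hq'. destruct (distance_bounds p' q' Hp' Hq') as (_ & H).
    fold J in H. lra. }
  repeat split; lra.
Qed.

Lemma total_abs_mean_curvature_eq :
  total_abs_mean_curvature L F = PI * RInt (fun s => Rabs (mean_density X Z s)) 0 L.
Proof.
  unfold total_abs_mean_curvature.
  assert (EI : ex_RInt (fun s => Rabs (mean_density X Z s)) 0 L).
  { apply ex_RInt_closed; [lra|]. intros s Hs.
    apply (continuous_comp (mean_density X Z) Rabs); [|apply continuous_Rabs].
    now apply (mean_density_continuous L). }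
  transitivity (RInt (fun s => scal PI (Rabs (mean_density X Z s))) 0 L);
    [|exact (RInt_scal (fun s => Rabs (mean_density X Z s)) 0 L PI EI)].
  apply RInt_ext. rewrite Rmin_left, Rmax_right by lra. intros s Hs.
  rewrite (RInt_ext _ (fun _ => Rabs (mean_density X Z s) / 2)).
  - rewrite RInt_const. unfold scal; simpl; unfold mult; simpl. field.
  - intros phi _. unfold F.
    rewrite (abs_mean_curvature_revolve b e1 e2 e3 x z (Derive X) (Derive Z) He s phi
      (Derive (Derive X) s) (Derive (Derive Z) s)).
    + unfold mean_density. rewrite EX by lra. reflexivity.
    + apply (locally_interval 0 L); [exact Hs|]. intros r Hr. now apply profile_derivatives.
    + apply (locally_interval 0 L); [exact Hs|]. intros r Hr. now apply profile_derivatives.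
    + apply Derive_correct, HX. lra.
    + apply Derive_correct, HZ. lra.
    + now apply Hpos.
    + now apply Hunit.
Qed.

End Geodesic.

Theorem theorem1p3 :
  exists sigma : R, 0 < sigma /\
    forall (L : R) (x z : R -> R) (b e1 e2 e3 omega : vec) (c : R -> vec),
      generating_curve L x z ->
      orthonormal e1 e2 e3 ->
      admissible L (revolve b e1 e2 e3 x z) e3 omega c ->
      1 / diameter (surface L (revolve b e1 e2 e3 x z))
        * total_abs_mean_curvature L (revolve b e1 e2 e3 x z)
      >= PI + sigma * U omega c.
Proof.
  pose proof PI_RGT_0 as HPI.
  exists (PI / 12). split; [lra|].
  intros L x z b e1 e2 e3 omega c Hgen He Hadm.
  destruct (profile_extension L x z Hgen) as (X & Z & Hext).
  destruct Hgen as (HL & Hx0 & Hz0 & HxL & HzL & _ & _ & _ & _ & Hpos & Hspeed & _ & _).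
  assert (HX : forall s, 0 <= s <= L -> C2_at X s) by (intros; now apply Hext).
  assert (HZ : forall s, 0 <= s <= L -> C2_at Z s) by (intros; now apply Hext).
  assert (EX : forall s, 0 <= s <= L -> X s = x s) by (intros; now apply Hext).
  assert (EZ : forall s, 0 <= s <= L -> Z s = z s) by (intros; now apply Hext).
  assert (X0 : X 0 = 0) by (rewrite EX; lra).
  assert (XL : X L = 0) by (rewrite EX; lra).
  assert (Z0 : Z 0 = 0) by (rewrite EZ; lra).
  assert (ZL : 0 <= Z L) by (rewrite EZ; lra).
  assert (Hunit : forall s, 0 < s < L -> Derive X s ^ 2 + Derive Z s ^ 2 = 1).
  { intros s Hs. rewrite <- (Hspeed s Hs). f_equal; f_equal; apply Derive_ext_loc;
      apply (locally_interval 0 L); trivial; intros t Ht; [apply EX | apply EZ]; lra. }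
  rewrite (total_abs_mean_curvature_eq L x z X Z) by assumption.
  pose proof (RInt_abs_mean_density_ge L X Z HL HX HZ X0 XL Hunit) as HI.
  destruct (diameter_bounds L x z X Z b e1 e2 e3) as (HD0 & HDL & HD); trivial.
  pose proof (U_le L x z X Z b e1 e2 e3 HL He HX HZ EX EZ X0 XL Z0 ZL Hunit omega c Hadm) as HU.
  set (D := diameter _) in *. set (I := RInt (fun s => Rabs (mean_density X Z s)) 0 L : R) in *.
  set (J := RInt (fun s => Derive X s ^ 2) 0 L : R) in *.
  assert (HZL : 0 <= L - Z L).
  { pose proof (height_lipschitz L X Z HZ Hunit 0 L ltac:(lra) ltac:(lra) ltac:(lra)) as H.
    apply Rabs_le_between in H. lra. }
  assert (HDU : D * U omega c <= L - Z L).
  { apply Rle_trans with (D * ((L - Z L) / L)).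
    - apply Rmult_le_compat_l; [lra|]. replace ((L - Z L) / L) with (1 - Z L / L) by (field; lra).
      exact HU.
    - apply Rle_trans with (L * ((L - Z L) / L)); [|right; field; lra].
      apply Rmult_le_compat_r; [|lra].
      apply Rmult_le_pos; [lra | left; now apply Rinv_0_lt_compat]. }
  apply Rle_ge.
  replace (1 / D * (PI * I)) with (PI / D * I) by (field; lra).
  replace (PI + PI / 12 * U omega c) with (PI / D * (D + D * U omega c / 12)) by (field; lra).
  apply Rmult_le_compat_l; [|lra].
  apply Rmult_le_pos; [lra | left; now apply Rinv_0_lt_compat].
Qed.
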